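(* Let $k\ge 1$ and $(\alpha_1,\dots,\alpha_k)\in(0,\pi)^k$. For every large $n$ there exists a set $E$ of $n$ points in $\mathbb{R}^2$ with $|\Lambda_k(E;\alpha_1,\dots,\alpha_k)|\gtrsim n^{\lfloor k/2\rfloor+2}$.
   Context: For points $x,y,z$ with $x\ne y\ne z$, $\angle(x,y,z)\in[0,\pi]$ denotes the angle at $y$ between $x-y$ and $z-y$. $\Lambda_k(E;\alpha_1,\dots,\alpha_k)$ is the set of tuples $(x_1,\dots,x_{k+2})\in E^{k+2}$ with $\angle(x_j,x_{j+1},x_{j+2})=\alpha_j$ for all $1\le j\le k$. $X(n)\gtrsim Y(n)$ means $Y(n)\le CX(n)$ for all $n>N$, with constants $C,N$ independent of $n$ (possibly depending on $k$ and the angles). *)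

(* Defs.v *)
From mathcomp Require Import all_boot all_order all_algebra finmap.
From mathcomp Require Import reals trigo.

Set Implicit Arguments.
Unset Strict Implicit.
Unset Printing Implicit Defensive.

Import Order.TTheory GRing.Theory Num.Theory.
Local Open Scope ring_scope.

Definition dot (R : realType) (d : nat) (u v : 'rV[R]_d) : R :=
  \sum_(i < d) u 0 i * v 0 i.

(* The library norm on 'rV[R]_d is the sup norm, hence this definition. *)
Definition enorm (R : realType) (d : nat) (u : 'rV[R]_d) : R :=
  Num.sqrt (dot u u).

(* Only meaningful when x != y and y != z: with the convention 0^-1 = 0 the
   degenerate cases evaluate to acos 0. *)
Definition angle (R : realType) (d : nat) (x y z : 'rV[R]_d) : R :=
  acos (dot (x - y) (z - y) / (enorm (x - y) * enorm (z - y))).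

(* Indices are 0-based: for j < k the angle a j is prescribed at the point of
   index j + 1, and j, j + 1, j + 2 are all < k + 2, so inord is exact.
   Non-consecutive points of a tuple may coincide. *)
Definition Lambda (R : realType) (d k : nat) (E : {fset 'rV[R]_d})
    (a : 'I_k -> R) : {set k.+2.-tuple E} :=
  [set t : k.+2.-tuple E | [forall j : 'I_k,
    let x := val (tnth t (inord j)) in
    let y := val (tnth t (inord j.+1)) in
    let z := val (tnth t (inord j.+2)) in
    [&& x != y, y != z & angle x y z == a j]]].

(* Main.v *)
(* The vertices run along lines l_0, l_1, l_2, ..., the direction of l_(i+1)
   being obtained from that of l_i by turning through the two angles prescribed
   between them.  A point moving on l_i at constant speed and a point moving on
   l_(i+1) at a suitable constant speed stay joined by a segment of constant
   direction, so a step from l_i to l_(i+1) is determined by one parameter in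
   {0, ..., N - 1}.  The points where the chain leaves l_i are all placed beyond
   those where it arrives, so the step made along l_i has constant direction
   whatever the two parameters are.  Hence all angles are as prescribed for any
   choice of the parameters, of which there are floor(k/2) + 2, while only
   (k + 2) N points are used. *)
Require Import Defs.
From mathcomp Require Import all_boot all_order all_algebra finmap.
From mathcomp Require Import reals trigo.
From mathcomp Require Import ring lra zify.

Set Implicit Arguments.
Unset Strict Implicit.
Unset Printing Implicit Defensive.

Import Order.TTheory GRing.Theory Num.Theory.
Local Open Scope ring_scope.

(** Pads the constructed points to exactly [n]; the tuples already found remain. *)
Lemma fset_superset_card (R : realType) (F : {fset 'rV[R]_2}) (n : nat) :
  (#|` F|%fset <= n)%N ->
  exists E : {fset 'rV[R]_2}, (F `<=` E)%fset /\ #|` E|%fset = n.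
Proof.
move=> Fn; rewrite -(subnKC Fn).
elim: (n - _)%N => [|p [E [FE cE]]]; first by exists F; rewrite addn0.
(* The first coordinate of [v] exceeds in absolute value that of every point of [E]. *)
pose v : 'rV[R]_2 := const_mx (1 + \sum_(x <- enum_fset E) `|x 0 0|).
have vE : v \notin E.
  apply/negP => vE.
  have : `|v 0 0| <= \sum_(x <- enum_fset E) `|x 0 0|.
    by rewrite (big_rem v) //= lerDl sumr_ge0.
  rewrite mxE => /(le_trans (ler_norm _)).
  lra.
exists (v |` E)%fset; split; last by rewrite cardfsU1 vE cE addnS.
exact: fsubset_trans FE (fsubsetUr _ _).
Qed.

Section Direction.
Variable R : realType.
Implicit Types x y c : R.

Definition dir x : 'rV[R]_2 := \row_(i < 2) if i == 0 then cos x else sin x.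

Lemma dot_dir c1 c2 x y :
  dot (c1 *: dir x) (c2 *: dir y) = c1 * c2 * cos (x - y).
Proof. by rewrite /dot !big_ord_recl big_ord0 !mxE /= cosB; ring. Qed.

Lemma enorm_dir c x : enorm (c *: dir x) = `|c|.
Proof. by rewrite /enorm dot_dir subrr cos0 mulr1 -expr2 sqrtr_sqr. Qed.

Lemma scale_dir_neq0 c x : c != 0 -> c *: dir x != 0.
Proof.
apply: contraNneq => c0; rewrite -normr_eq0 -(enorm_dir c x) c0.
rewrite /enorm /dot big1 ?sqrtr0 // => i _.
by rewrite mxE mul0r.
Qed.

(** A common sign of [c1] and [c2] cancels in the quotient, so both segments may also run against
    their directions. *)
Lemma angle_dir (p q r : 'rV[R]_2) c1 c2 x y b :
  0 < c1 * c2 -> p - q = c1 *: dir x -> r - q = c2 *: dir y ->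
  0 <= b <= pi -> cos (x - y) = cos b ->
  [&& p != q, q != r & angle p q r == b].
Proof.
move=> c12_gt0 pq rq b0pi cos_xy.
have /andP[c1_neq0 c2_neq0] : (c1 != 0) && (c2 != 0).
  by rewrite -negb_or -mulf_eq0 lt0r_neq0.
rewrite -(subr_eq0 p) pq scale_dir_neq0 //= (eq_sym q) -(subr_eq0 r) rq.
rewrite scale_dir_neq0 //= /angle pq rq dot_dir !enorm_dir -normrM.
by rewrite (gtr0_norm c12_gt0) mulrAC divff ?lt0r_neq0 // mul1r cos_xy cosK.
Qed.

(* The identity that gives [chain_odd i t - chain_even i t] a direction
   independent of [t]. *)
Lemma sin_dir x b c :
  sin b *: dir (x - b + c) = sin c *: dir x + sin (b - c) *: dir (x - b).
Proof.
have -> : dir x = dir (x - b + b) by rewrite subrK.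
move: (x - b) => z; apply/rowP => i; rewrite !mxE.
by case: ifP => _; rewrite !(cosD, sinD, cosN, sinN); ring.
Qed.

End Direction.

Section Chain.
Variables (R : realType) (A : nat -> R) (N : nat).
Hypothesis A_range : forall l, 0 < A l < pi.

Fixpoint heading (i : nat) : R :=
  if i is i'.+1 then heading i' - A i'.*2 + A i'.*2.+1 else 0.

(** Origin of the departures on l_i; for [i > 0] it lies [N] beyond the origin of the arrivals. *)
Fixpoint base (i : nat) : 'rV[R]_2 :=
  if i is i'.+1
  then base i' - N%:R *: dir (heading i' - A i'.*2) + N%:R *: dir (heading i)
  else 0.

(** Departures from l_i. As in the law of sines, the speed on each of l_i and l_(i+1) is the sine of
    the angle at the other. *)
Definition chain_even (i t : nat) : 'rV[R]_2 :=
  base i + (t%:R * sin (A i.*2.+1)) *: dir (heading i).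

(** Arrivals on l_(i+1). The offset of length [N] keeps the segment from [chain_even i t]
    nondegenerate for [t < N]. *)
Definition chain_odd (i t : nat) : 'rV[R]_2 :=
  base i - N%:R *: dir (heading i - A i.*2)
  + (t%:R * sin (A i.*2)) *: dir (heading i.+1).

Definition chain (l t : nat) : 'rV[R]_2 :=
  if odd l then chain_odd l./2 t else chain_even l./2 t.

Lemma chain_double i t : chain i.*2 t = chain_even i t.
Proof. by rewrite /chain odd_double doubleK. Qed.

Lemma chain_doubleS i t : chain i.*2.+1 t = chain_odd i t.
Proof. by rewrite /chain /= odd_double uphalf_double. Qed.

Lemma chain_odd_sub_even i t :
  chain_odd i t - chain_even i t =
  - (N%:R - t%:R * sin (A i.*2 - A i.*2.+1)) *: dir (heading i - A i.*2).
Proof.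
rewrite /chain_odd /chain_even -[(t%:R * sin (A i.*2)) *: _]scalerA /=.
rewrite sin_dir scalerDr !scalerA; apply/rowP => j; rewrite !mxE.
by case: ifP => _; ring.
Qed.

Lemma chain_even_sub_odd i s t :
  chain_even i.+1 t - chain_odd i s =
  (N%:R + t%:R * sin (A i.+1.*2.+1) - s%:R * sin (A i.*2))
    *: dir (heading i.+1).
Proof.
rewrite /chain_odd /chain_even [base i.+1]/=; set h := heading i.+1.
by apply/rowP => j; rewrite !mxE; case: ifP => _; ring.
Qed.

Lemma mulr_sin_lt t x : (t < N)%N -> t%:R * sin x < N%:R :> R.
Proof.
move=> tN; apply: (@le_lt_trans _ _ t%:R); last by rewrite ltr_nat.
by rewrite ler_piMr ?sin_le1.
Qed.

Lemma sin_A_gt0 l : 0 < sin (A l).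
Proof. exact: sin_gt0_pi. Qed.

Lemma even_odd_scale_gt0 i t : (t < N)%N ->
  0 < N%:R - t%:R * sin (A i.*2 - A i.*2.+1).
Proof. by move=> tN; rewrite subr_gt0 mulr_sin_lt. Qed.

Lemma odd_even_scale_gt0 i s t : (s < N)%N ->
  0 < N%:R + t%:R * sin (A i.+1.*2.+1) - s%:R * sin (A i.*2).
Proof.
move=> sN; rewrite addrAC ltr_wpDr // ?subr_gt0 ?mulr_sin_lt //.
by rewrite mulr_ge0 // ltW ?sin_A_gt0.
Qed.

(** Halving the position makes the two ends of a step from l_i to l_(i+1) share the parameter
    [f i]. *)
Lemma angle_chain (l : nat) (f : nat -> nat) : (forall g, f g < N)%N ->
  [&& chain l (f l./2) != chain l.+1 (f l.+1./2),
      chain l.+1 (f l.+1./2) != chain l.+2 (f l.+2./2)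
    & angle (chain l (f l./2)) (chain l.+1 (f l.+1./2))
        (chain l.+2 (f l.+2./2)) == A l.+1].
Proof.
move=> fN; have A0pi j : 0 <= A j <= pi.
  by have /andP[/ltW-> /ltW->] := A_range j.
rewrite -[l]odd_double_half; move: (l./2) => i.
case: (odd l); rewrite ?add1n ?add0n -?doubleS.
  (* The vertex is a departure: both differences are negative multiples of their directions. At an
     arrival, treated next, both are positive. *)
  rewrite !chain_doubleS !chain_double /= !uphalf_double !doubleK.
  have pq := congr1 -%R (chain_even_sub_odd i (f i) (f i.+1)).
  rewrite opprB -scaleNr in pq.
  apply: (angle_dir _ pq (chain_odd_sub_even i.+1 (f i.+1))) => //.
    by rewrite mulrNN mulr_gt0 ?odd_even_scale_gt0 ?even_odd_scale_gt0.
  by rewrite subKr.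
rewrite !chain_doubleS !chain_double /= !uphalf_double !doubleK.
have pq := congr1 -%R (chain_odd_sub_even i (f i)).
rewrite opprB -scaleNr opprK in pq.
apply: (angle_dir _ pq (chain_even_sub_odd i (f i) (f i.+1))) => //.
  by rewrite mulr_gt0 ?odd_even_scale_gt0 ?even_odd_scale_gt0.
by rewrite /= opprD addrA subrr add0r cosN.
Qed.

Lemma chain_inj l : injective (chain l).
Proof.
have dir_inj (v : 'rV[R]_2) c x : 0 < c ->
    injective (fun t : nat => v + (t%:R * c) *: dir x).
  move=> c_gt0 s t /addrI/eqP; rewrite -subr_eq0 -scalerBl.
  have [/eqP|/(scale_dir_neq0 x)/negPf->//] := eqVneq (s%:R * c - t%:R * c) 0.
  rewrite subr_eq0 => /eqP/(mulIf (lt0r_neq0 c_gt0))/eqP.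
  by rewrite eqr_nat => /eqP.
by rewrite /chain; case: (odd l) => s t;
  apply: dir_inj; apply: sin_A_gt0.
Qed.

End Chain.

Lemma leq_expn_Lambda (R : realType) (k N : nat) (a : 'I_k -> R)
    (y : nat -> nat -> 'rV[R]_2)
    (E : {fset 'rV[R]_2}) :
  (forall l, injective (y l)) ->
  (forall j t, (j < k.+2)%N -> (t < N)%N -> y j t \in E) ->
  (forall (f : nat -> nat) (j : 'I_k), (forall g, f g < N)%N ->
    let x i := y i (f i.+1./2) in
    [&& x j != x j.+1, x j.+1 != x j.+2 & angle (x j) (x j.+1) (x j.+2) == a j])
  -> (N ^ (k %/ 2 + 2) <= #|Lambda E a|)%N.
Proof.
move=> y_inj yE y_angle; rewrite addn2.
pose x (f : {ffun 'I_(k %/ 2).+2 -> 'I_N}) (j : 'I_k.+2) : 'rV[R]_2 :=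
  y j (f (inord j.+1./2)).
have xE f j : x f j \in E by apply: yE.
pose T f : k.+2.-tuple E := [tuple [` xE f j]%fset | j < k.+2].
have T_inj : injective T.
  move=> f g fg; apply/ffunP => i.
  (* Parameter [i] is read off at index [2i - 1], truncated to 0 for [i = 0]. *)
  have ltj : (i.*2.-1 < k.+2)%N by case: i => i /=; lia.
  have := congr1 (fun t => val (tnth t (Ordinal ltj))) fg.
  rewrite !tnth_mktuple /= => /y_inj/val_inj.
  suff -> : (i.*2.-1.+1)./2 = i by rewrite inord_val.
  by lia.
rewrite -[N in (N ^ _)%N]card_ord -[in X in (_ ^ X)%N](card_ord (k %/ 2).+2).
rewrite -card_ffun -(card_imset _ T_inj).
apply/subset_leq_card/subsetP => _ /imsetP[f _ ->].
rewrite inE; apply/forallP => j; rewrite !tnth_mktuple /=.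
have jk := ltn_ord j.
have := y_angle (fun g => f (inord g)) j (fun=> ltn_ord _).
by rewrite /x !inordK ?(ltn_trans jk) // ltnS ltnW.
Qed.

Theorem theorem2p2 (R : realType) (k : nat) (a : 'I_k -> R)
    (hk : (1 <= k)%N) (ha : forall j : 'I_k, 0 < a j < pi) :
  exists (C : R) (N : nat), 0 < C /\
    forall n : nat, (N < n)%N ->
      exists E : {fset 'rV[R]_2}, #|` E|%fset = n /\
        (n ^ (k %/ 2 + 2))%:R <= C * #|Lambda E a|%:R.
Proof.
(* For [n > k + 2] the quotient [N] of [n] by [k + 2] is positive, whence [n <= 2 * (k + 2) * N]. *)
exists ((2 * k.+2) ^ (k %/ 2 + 2))%:R, k.+2; split.
  by rewrite ltr0n expn_gt0.
move=> n k2n; pose N := (n %/ k.+2)%N.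
have N_gt0 : (0 < N)%N by rewrite divn_gt0 // ltnW.
(* [A l] is prescribed at position [l] of the chain; the tuple starts at
   position 1, so [a j] goes to position [j + 2]. *)
pose A l : R :=
  if insub (l - 2)%N is Some j then a j else pi / 2.
have A_range l : 0 < A l < pi.
  rewrite /A; case: insub => [j|]; first exact: ha.
  by have := pi_gt0 R; lra.
(* Starting at position 1 gives the first vertex a parameter of its own; starting at 0 would lose
   one parameter for even [k]. *)
pose y j := chain A N j.+1.
pose F : {fset 'rV[R]_2} :=
  [fset y (nat_of_ord p.1) (nat_of_ord p.2) | p in {: 'I_k.+2 * 'I_N}]%fset.
have F_le_n : (#|` F|%fset <= n)%N.
  apply: leq_trans (leq_imfset_card _ _ _) _.
  by rewrite -cardE card_prod !card_ord mulnC leq_trunc_div.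
have [E [/fsubsetP FE cardE]] := fset_superset_card F_le_n.
exists E; split=> //; rewrite -natrM ler_nat.
apply: (@leq_trans ((2 * k.+2) ^ (k %/ 2 + 2) * N ^ (k %/ 2 + 2))).
  rewrite -expnMn leq_exp2r ?addn2 // -mulnA mul2n -addnn (mulnC _ N).
  rewrite {1}(divn_eq n k.+2) leq_add2l.
  by apply: leq_trans (ltnW (ltn_pmod n _)) (leq_pmull _ N_gt0).
rewrite leq_mul2l; apply/orP; right.
apply: (@leq_expn_Lambda _ _ _ _ y) => [l||f j fN].
- exact: chain_inj.
- move=> j t jk tN; apply: FE; apply/imfsetP.
  by exists (Ordinal jk, Ordinal tN).
- have := angle_chain A_range j.+1 fN.
  by rewrite [A j.+2]/A subn2 valK.
Qed.
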